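(* Let $F=F_\tau^{l_1,l_2,l_3}\in\mathrm{CET}^3_\tau$ with $\tau\in[0,\frac12]$. Suppose that $\max\{l_j\}_{j=1}^3\le\frac12$ and $\tau>\max\{l_j\}_{j=1}^3$. Put $x_j=1-2l_j$ ($j=1,2,3$) and $r=\frac12-\tau$. Then the following holds. 1. The map $T=F^2:\mathbb{S}^1\to\mathbb{S}^1$ is a $6$-interval exchange transformation with intervals of continuity $I_j^\pm$ of lengths $|I_j^\pm|=\frac{x_j}{2}\pm r$, $j\in\{1,2,3\}$. Moreover, $I_j^+$ and $I_j^-$ are neighbouring, and their images $T(I_j^+)$ and $T(I_j^-)$ are neighbouring as well. 2. Suppose that $l_j=\min\{l_1,l_2,l_3\}$ for some $j\in\{1,2,3\}$. Consider the interval $S_j:=I_j^+\cup I_j^-=:(s_j^-,s_j^+)$ and glue its endpoints to obtain a circle $S_j/(s_j^-\sim s_j^+)$. Then the first return map of $F$ to this circle is well defined. Let $R_jF:\mathbb{S}^1\to\mathbb{S}^1$ be its rescaling to the unit circle. Then $R_jF\in\mathrm{CET}^3_\tau$, and its parameters $(l_1',l_2',l_3',\tau')\in\Delta_2\times[0,\frac12]$ are as follows: $(l_1',l_2',l_3')$ is the image of $(l_1,l_2,l_3)$ under the fully subtractive algorithm, and $$\tau'=\frac12-r',\qquad r'=\frac{r}{|S_j|}\ge r.$$ 3. The map $R_jF$ has a $2$-periodic interval if and only if $l_j\ge\frac14-\frac r2$.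
   Context: $\Delta_2=\{(l_1,l_2,l_3): l_i\ge0,\ l_1+l_2+l_3=1\}$, $\mathbb{S}^1=\mathbb{R}/\mathbb{Z}$ is the circle of length $1$. The family $\mathrm{CET}^3_\tau$ of fully flipped $3$-interval exchange transformations on the circle: for $(l_1,l_2,l_3)\in\Delta_2$ and $\tau\in\mathbb{S}^1$, cut $\mathbb{S}^1$ into $I_1=(0,l_1)$, $I_2=(l_1,l_1+l_2)$, $I_3=(l_1+l_2,1)$; let $F_0$ be the map that reverses each $I_j$ (acts on it as the reflection about its midpoint), and let $F_\tau^{l_1,l_2,l_3}=R_\tau\circ F_0$, where $R_\tau(p)=p+\tau$. Maps are considered up to their values at the finitely many endpoints, and membership in $\mathrm{CET}^3_\tau$ after rescaling is understood with the origin of the circle placed at the beginning of the first interval of continuity. The intervals $I_j^\pm$ (mod $1$) are $I_2^+=(l_2+\tau,1)$, $I_2^-=(0,\tau-l_2)$, $I_3^+=(\tau-l_2,l_1)$, $I_3^-=(l_1,l_1+\tau-l_3)$, $I_1^+=(l_1+\tau-l_3,l_1+l_2)$, $I_1^-=(l_1+l_2,l_2+\tau)$; $S_j$ includes the common endpoint of $I_j^+$ and $I_j^-$. Fully subtractive algorithm: if $l_j=\min\{l_1,l_2,l_3\}$, replace $l_k$ by $l_k-l_j$ for $k\ne j$, keep $l_j$, and rescale the triple to have sum $1$. An interval $I\subset\mathbb{S}^1$ is $k$-periodic for a map $G$ if $G^k|_I=\mathrm{id}$ and $k\ge1$ is minimal with this property.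
   Formalization: Part 3 is proved with strict inequality l_j > 1/4 − r/2 instead of ≥: at equality the claim fails, e.g. l = (0.24, 0.38, 0.38), τ = 0.48, j = 1, where τ' = l_1' = 12/26 and the renormalized map has no 2-periodic interval. *)

(* Defs.v *)
(* MathComp / MathComp-Analysis, over an arbitrary realType R. *)
From HB Require Import structures.
From mathcomp Require Import all_boot all_order all_algebra.
From mathcomp Require Import boolp classical_sets functions cardinality.
From mathcomp Require Import set_interval reals topology normedtype.
Set Implicit Arguments.
Unset Strict Implicit.
Unset Printing Implicit Defensive.
Import Order.TTheory GRing.Theory Num.Theory.
Import numFieldNormedType.Exports.
Local Open Scope classical_set_scope.
Local Open Scope ring_scope.

(* The subgroup Z of R: the predicate underlying Num.int, with its structure. *)
Definition integers (R : realType) : zmodClosed R :=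
  GRing.ZmodClosed.clone R (@Num.int_num_subdef R) _.

(* R/Z with the quotient topology; the group structure, which the alias       *)
(* quotient_topology does not inherit, is that of Quotient.quot.              *)
Definition circle (R : realType) : Type :=
  quotient_topology (Quotient.quot (integers R)).

HB.instance Definition _ (R : realType) := Topological.on (circle R).
HB.instance Definition _ (R : realType) := Quotient.on (circle R).
HB.instance Definition _ (R : realType) :=
  GRing.isZmodule.Build (circle R)
    (@Quotient.addqA R (integers R)) (@Quotient.addqC R (integers R))
    (@Quotient.add0q R (integers R)) (@Quotient.addNq R (integers R)).

Definition circ (R : realType) (x : R) : circle R := (\pi_(circle R) x)%qT.

(* The representative of p in [0, 1[. *)
Definition unit_coord (R : realType) (p : circle R) : R :=
  repr p - (Num.floor (repr p))%:~R.

(* The open arc from a to b; it has length b - a when b - a <= 1. *)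
Definition open_arc (R : realType) (a b : R) : set (circle R) :=
  [set circ x | x in [set x | a < x < b]].

Definition neighbouring (R : realType) (A B : set (circle R)) :=
  exists a b c : R, [/\ a < b, b < c, c <= a + 1 &
    (A = open_arc a b /\ B = open_arc b c) \/
    (B = open_arc a b /\ A = open_arc b c)].

(* T is an exchange of n = #|K| intervals with intervals of continuity I k:   *)
(* T translates each I k and is discontinuous at each of the finitely many    *)
(* remaining points.                                                          *)
Definition interval_exchange (R : realType) (n : nat) (T : circle R -> circle R)
    (K : finType) (I : K -> set (circle R)) :=
  #|K| = n /\
  [/\ forall k, exists a b : R, [/\ a < b, b <= a + 1 & I k = open_arc a b],
      trivIset setT I /\ finite_set (~` \bigcup_k I k),
      forall k, exists t, forall p, I k p -> T p = p + t,
      trivIset setT (fun k => T @` I k) &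
      forall p, ~ (\bigcup_k I k) p -> ~ {for p, continuous T}].

Definition id_off_finite (R : realType) (G : circle R -> circle R)
    (I : set (circle R)) :=
  finite_set [set p | I p /\ G p <> p].

(* Maps are only considered up to their values at finitely many points.       *)
Definition periodic_interval (R : realType) (k : nat) (G : circle R -> circle R)
    (I : set (circle R)) :=
  [/\ exists a b : R, [/\ a < b, b <= a + 1 & I = open_arc a b],
      (0 < k)%N, id_off_finite (iter k G) I &
      forall m, (0 < m < k)%N -> ~ id_off_finite (iter m G) I].

Definition simplex (R : realType) (l : 'I_3 -> R) :=
  (forall j, 0 <= l j) /\ \sum_j l j = 1.

(* The left endpoint of the j-th interval I_j = (cut l j, cut l j + l j). *)
Definition cut (R : realType) (l : 'I_3 -> R) (j : 'I_3) : R :=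
  \sum_(i < 3 | (i < j)%N) l i.

(* F = R_tau o F_0, where F_0 is the reflection of each I_j about its         *)
(* midpoint; the values of F at the endpoints of the I_j are arbitrary.       *)
Definition flipped_exchange (R : realType) (l : 'I_3 -> R) (tau : R)
    (F : circle R -> circle R) :=
  forall (j : 'I_3) (x : R), cut l j < x < cut l j + l j ->
    F (circ x) = circ (cut l j + (cut l j + l j) - x) + circ tau.

(* G is, off a finite set, the map with parameters l, tau on the circle whose *)
(* origin has been moved to o, the beginning of the first interval.           *)
Definition in_CET3 (R : realType) (l : 'I_3 -> R) (tau : R)
    (G : circle R -> circle R) :=
  exists (o : circle R) (F : circle R -> circle R),
    flipped_exchange l tau F /\ finite_set [set p | G p <> o + F (p - o)].

Definition j1 : 'I_3 := @Ordinal 3 0 isT.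
Definition j2 : 'I_3 := @Ordinal 3 1 isT.
Definition j3 : 'I_3 := @Ordinal 3 2 isT.

(* The endpoints of I_j^+ (s = true) and I_j^- (s = false). *)
Definition bounds (R : realType) (l : 'I_3 -> R) (tau : R) (j : 'I_3) (s : bool)
    : R * R :=
  match val j, s with
  | 0%N, true => (l j1 + tau - l j3, l j1 + l j2)
  | 0%N, false => (l j1 + l j2, l j2 + tau)
  | 1%N, true => (l j2 + tau, 1)
  | 1%N, false => (0, tau - l j2)
  | _, true => (tau - l j2, l j1)
  | _, false => (l j1, l j1 + tau - l j3)
  end.

Definition Ipm (R : realType) (l : 'I_3 -> R) (tau : R) (j : 'I_3) (s : bool) :=
  open_arc (bounds l tau j s).1 (bounds l tau j s).2.

Definition Ipm_length (R : realType) (l : 'I_3 -> R) (tau : R) (j : 'I_3)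
    (s : bool) : R :=
  (bounds l tau j s).2 - (bounds l tau j s).1.

Definition Sj (R : realType) (l : 'I_3 -> R) (tau : R) (j : 'I_3) :
    set (circle R) :=
  Ipm l tau j true `|` Ipm l tau j false
    `|` [set circ (bounds l tau j true).2].

(* I_j^+ comes first in S_j; s_j^+ is lifted so that |S_j| = s_j^+ - s_j^-. *)
Definition S_length (R : realType) (l : 'I_3 -> R) (tau : R) (j : 'I_3) : R :=
  Ipm_length l tau j true + Ipm_length l tau j false.

Definition s_minus (R : realType) (l : 'I_3 -> R) (tau : R) (j : 'I_3) : R :=
  (bounds l tau j true).1.

Definition s_plus (R : realType) (l : 'I_3 -> R) (tau : R) (j : 'I_3) : R :=
  s_minus l tau j + S_length l tau j.

Definition return_time (T : Type) (A : set T) (F : T -> T) (p : T) (n : nat) :=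
  [/\ (0 < n)%N, A (iter n F p) &
      forall m, (0 < m < n)%N -> ~ A (iter m F p)].

(* Total version of the first return map; the identity where F never returns. *)
Definition first_return (T : Type) (A : set T) (F : T -> T) (p : T) : T :=
  iter (xget 0%N (return_time A F p)) F p.

(* Chart of the circle obtained from the arc (a, b) by gluing its endpoints   *)
(* (to the point 0) and rescaling by 1 / (b - a), and its inverse.            *)
Definition glue_arc (R : realType) (a b : R) (u : circle R) : circle R :=
  circ (a + (b - a) * unit_coord u).

Definition unglue_arc (R : realType) (a b : R) (p : circle R) : circle R :=
  circ (unit_coord (p - circ a) / (b - a)).

Definition renormalization (R : realType) (a b : R) (F : circle R -> circle R)
    : circle R -> circle R :=
  unglue_arc a b \o first_return (open_arc a b) F \o glue_arc a b.

Definition subtract (R : realType) (l : 'I_3 -> R) (j : 'I_3) : 'I_3 -> R :=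
  fun k => if k == j then l j else l k - l j.

Definition fully_subtractive (R : realType) (l : 'I_3 -> R) (j : 'I_3)
    : 'I_3 -> R :=
  fun k => subtract l j k / \sum_i subtract l j i.

(* Main.v *)
Require Import Defs.
From HB Require Import structures.
From mathcomp Require Import all_boot all_order all_algebra.
From mathcomp Require Import boolp classical_sets functions cardinality.
From mathcomp Require Import set_interval reals topology normedtype.
From mathcomp Require Import ring lra zify.
Set Implicit Arguments.
Unset Strict Implicit.
Unset Printing Implicit Defensive.
Import Order.TTheory GRing.Theory Num.Theory.
Import numFieldNormedType.Exports.
Local Open Scope classical_set_scope.
Local Open Scope ring_scope.

(** The reason behind the theorem is that everything happens around one point
at a time. Fix j and put the origin of the circle at the common endpoint o of
I_j^+ and I_j^-. Since o is where the interval preceding I_j cyclically meets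
the one following it, the three flipped arcs now appear in the order
a, b, c, with b = l_j the arc opposite to o. Changing j only rotates the roles
of the three lengths, so one computation serves all indices; the predicate
[three_flips] is built for this, and [three_flips_rot] is the rotation.

Seen from o, F flips (o, o + tau - b) into the arc c and then flips it again,
so F^2 moves it by + b; symmetrically F^2 moves (o - (1 - b - tau), o) by - b
([square_translates]). For the three indices this gives six translated arcs.
The six arcs, and also their six images, are the pieces of increasing
subdivisions of one turn, which yields disjointness, and at each of the six
division points the two one-sided translations differ modulo 1, so no value
there can make F^2 continuous ([square_interval_exchange]).

For the smallest length b, the arc S_j = (o - (1 - b - tau), o + tau - b) has
length 1 - 2b. The points of the arc a that are within a - b of o come back
after one step, and likewise those of the arc c within c - b of o. The rest of
S_j needs three steps: F^2 pushes it by b onto the removed arc, into the flipped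
arc b, and the third flip brings it back ([return_times]). Each return is a
flip, and after gluing the endpoints of S_j the two outer arcs become a single
flipped arc of length b. So the first return map is an exchange of three
flipped arcs of lengths a - b, b, c - b and rotation tau - b on a circle of
length 1 - 2b ([renormalization_flips]); rescaling gives the stated parameters.

For the last part, the square of a flipped exchange is, on a small arc going
from piece i to piece k, the translation by the difference of twice the
midpoints. If i <> k this is, modulo 1 and up to sign, the third length, so it
is trivial only if a length vanishes ([midpoints_congruent]); if i = k the
square is the identity, and such an arc exists iff piece i meets its own
translate by tau, that is iff tau < l_i. For the renormalized lengths
a - b < tau - b and c - b < tau - b, so only piece j can do this, when
tau - b < b; and a vanishing length, a = b say, leaves
c = 1 - 2b < tau <= 1/2, which forces b > 1/4. *)

(** * The circle and its arcs *)

Lemma circ_eqP (R : realType) (x y : R) :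
  circ x = circ y <-> exists n : int, x - y = n%:~R.
Proof.
have -> : circ x = circ y <-> (x - y) \in integers R.
  rewrite Quotient.idealrBE; split=> [e|/eqP//]; exact/eqP.
split=> [/intrP|xy]; [exact | exact/intrP].
Qed.

Lemma circD (R : realType) (x y : R) : circ x + circ y = circ (x + y).
Proof. exact/esym/(@Quotient.pi_add R (integers R)). Qed.

Lemma circN (R : realType) (x : R) : - circ x = circ (- x).
Proof. exact/esym/(@Quotient.pi_opp R (integers R)). Qed.

Lemma circB (R : realType) (x y : R) : circ x - circ y = circ (x - y).
Proof. by rewrite circN circD. Qed.

Lemma circ_reprK (R : realType) (p : circle R) : circ (repr p) = p.
Proof. exact: reprK. Qed.

Lemma circ_shift (R : realType) (n : int) (x y : R) :
  x = y + n%:~R -> circ x = circ y.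
Proof. by move=> ->; apply/circ_eqP; exists n; lra. Qed.

Lemma circ_continuous (R : realType) : continuous (@circ R).
Proof. exact: pi_continuous. Qed.

Lemma int_small (R : realType) (n : int) : -1 < (n%:~R : R) < 1 -> n = 0.
Proof.
have -> : -1 = (-1)%:~R :> R by [].
by rewrite ltr_int (ltr_int R n 1) => ?; lia.
Qed.

Lemma circ_inj (R : realType) (x y : R) :
  -1 < x - y < 1 -> circ x = circ y -> x = y.
Proof.
move=> xy /circ_eqP[n e]; move: xy; rewrite e => /int_small n0.
by move: e; rewrite n0; lra.
Qed.

Lemma unit_coord_itv (R : realType) (p : circle R) : 0 <= unit_coord p < 1.
Proof.
rewrite /unit_coord subr_ge0 Num.Theory.floor_le/=.
by have := Num.Theory.floorD1_gt (repr p); rewrite intrD; lra.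
Qed.

Lemma unit_coordK (R : realType) (p : circle R) : circ (unit_coord p) = p.
Proof.
rewrite -[RHS]circ_reprK; apply: (@circ_shift _ (- Num.floor (repr p))).
by rewrite mulrNz.
Qed.

Lemma circK (R : realType) (x : R) : 0 <= x < 1 -> unit_coord (circ x) = x.
Proof.
move=> x01; apply: circ_inj; last exact: unit_coordK.
by have := unit_coord_itv (circ x); lra.
Qed.

(** Points of the circle are handled through their lift to a turn that starts
at a convenient place. *)
Lemma circ_turn (R : realType) (o : R) (p : circle R) :
  exists2 x, o <= x < o + 1 & circ x = p.
Proof.
exists (o + unit_coord (p - circ o)); last first.
  by rewrite -circD unit_coordK addrC subrK.
by have := unit_coord_itv (p - circ o); lra.
Qed.

Lemma arc_circ (R : realType) (u v x : R) :
  open_arc u v (circ x) <-> exists n : int, u < x + n%:~R < v.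
Proof.
split=> [[y /= uyv /circ_eqP[n yx]]|[n uxv]].
  by exists n; rewrite -yx; lra.
by exists (x + n%:~R) => //; apply: (@circ_shift _ n).
Qed.

Lemma in_arc (R : realType) (n : int) (u v x : R) :
  u < x + n%:~R < v -> open_arc u v (circ x).
Proof. by move=> ux; apply/arc_circ; exists n. Qed.

Lemma notin_arc (R : realType) (u v x : R) :
  v <= x <= u + 1 -> ~ open_arc u v (circ x).
Proof.
move=> vx /arc_circ[n ux]; have n0 : n = 0 by apply: (@int_small R); lra.
by move: ux; rewrite n0; lra.
Qed.

Lemma arc_shift (R : realType) (n : int) (u v u' v' : R) :
  u' = u + n%:~R -> v' = v + n%:~R -> open_arc u' v' = open_arc u v.
Proof.
move=> -> ->; apply/seteqP; split=> _ [x /= ux <-].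
  by apply: (@in_arc _ (- n)); rewrite mulrNz; lra.
by apply: (@in_arc _ n); lra.
Qed.

(** The saturation of an open set is the union of its integer translates. *)
Lemma open_circ_image (R : realType) (A : set R) :
  open A -> open (@circ R @` A : set (circle R)).
Proof.
move=> oA; rewrite /open/= /quotient_open.
have -> : (\pi_(circle R) @^-1` (@circ R @` A))%qT =
    \bigcup_(n : int) (fun x : R => x + n%:~R) @^-1` A.
  apply/seteqP; split=> x.
    move=> [y Ay /circ_eqP[n yx]]; exists n => //=.
    by rewrite -yx addrC subrK.
  by move=> [n _ /= An]; exists (x + n%:~R) => //; apply: (@circ_shift _ n).
apply: bigcup_open => n _; apply: open_comp => // x _.
by apply: continuousD; [exact: cvg_id | exact: cvg_cst].
Qed.

(** The circle is Hausdorff, in the form used to detect discontinuities: along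
points accumulating at x on either side, a continuous T takes at x the value
predicted by the translation that it follows there. *)
Lemma continuous_translation (R : realType) (T : circle R -> circle R)
    (x y : R) :
  {for circ x, continuous T} ->
  (forall e, 0 < e ->
     exists2 s, -e < s < e & T (circ (x + s)) = circ (y + s)) ->
  T (circ x) = circ y.
Proof.
move=> Tc near; apply: contrapT => Txy.
have [z yz Tz] := circ_turn y (T (circ x)).
have zy : z != y by apply/eqP => zy; apply: Txy; rewrite -Tz zy.
have {}yz : 0 < z - y < 1 by move: yz zy; lra.
(* Arcs of radius d around circ y and circ z are disjoint. *)
pose d := Num.min (z - y) (1 - (z - y)) / 2.
have d0 : 0 < d by rewrite divr_gt0 // lt_min; lra.
have [dz dz1] : 2 * d <= z - y /\ 2 * d <= 1 - (z - y).
  by rewrite /d [2 * _]mulrC divfK ?pnatr_eq0// !ge_min !lexx orbT.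
have oU : open (open_arc (z - d) (z + d)).
  apply: open_circ_image.
  rewrite (_ : mkset _ = `]z - d, z + d[%classic); first exact: itv_open.
  by apply/seteqP; split=> w /=; rewrite in_itv.
have Uz : open_arc (z - d) (z + d) (T (circ x)).
  by rewrite -Tz; apply: (@in_arc _ 0); lra.
have /(_ x) := @circ_continuous R; move=> /(_ _ _)/=.
have TxU : nbhs (circ x) (T @^-1` open_arc (z - d) (z + d)).
  by apply: Tc; exact: open_nbhs_nbhs.
move=> /(_ _ TxU)/nbhs_ballP[e /= e0 eU].
have [|s se Ts] := near (Num.min e d); first by rewrite lt_min e0.
have sm : Num.min e d <= e /\ Num.min e d <= d.
  by rewrite !ge_min !lexx orbT.
have : open_arc (z - d) (z + d) (T (circ (x + s))).
  by apply: eU; rewrite /ball/=/ball_/= opprD addNKr normrN ltr_norml; lra.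
by rewrite Ts -(@circ_shift _ 1 (y + s + 1))//; apply: notin_arc; lra.
Qed.

(** This makes statements up to finitely many points usable: instead of
tracking preimages of an exceptional set, shrink to an arc that avoids it. *)
Lemma subarc_avoiding (R : realType) (D : set (circle R)) (u v : R) :
  finite_set D -> u < v ->
  exists u' v', [/\ u <= u', u' < v', v' <= v &
    forall x, u' < x < v' -> ~ D (circ x)].
Proof.
move=> /finite_seqP[s ->] {D} uv.
elim: s => [|q s [u1 [v1 [uu1 uv1 v1v sD]]]].
  by exists u, v; split=> // x _; rewrite /= inE.
(* On less than a turn, the point q has at most one lift. *)
pose v2 := Num.min v1 (u1 + 1).
have v2m : v2 <= v1 /\ v2 <= u1 + 1 by rewrite !ge_min !lexx orbT.
have uv2 : u1 < v2 by rewrite lt_min uv1; lra.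
have [[x xuv xq]|nox] := pselect (exists2 x, u1 < x < v2 & circ x = q).
  exists u1, x; split; [lra|lra|lra|] => y xy.
  rewrite /= inE => /orP[/eqP yq|/(sD y)]; last by apply; lra.
  by have : y = x by [apply: circ_inj; [lra|rewrite xq]]; lra.
exists u1, v2; split; [lra|lra|lra|] => y xy.
rewrite /= inE => /orP[/eqP yq|/(sD y)]; last by apply; lra.
by apply: nox; exists y.
Qed.

(** * Exchanges of three flipped arcs *)

Definition flips_on (R : realType) (F : circle R -> circle R) (tau u v : R) :=
  forall x, u < x < v -> F (circ x) = circ (u + v - x + tau).

(** Here o is a real lift of the origin. With a + b + c = 1 the same map can be
read from the origin o + a with lengths b, c, a, so the cyclic symmetry of the
problem is a change of origin. *)
Definition three_flips (R : realType) (F : circle R -> circle R)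
    (tau o a b c : R) :=
  [/\ flips_on F tau o (o + a), flips_on F tau (o + a) (o + a + b) &
      flips_on F tau (o + a + b) (o + a + b + c)].

(** These inequalities make all three lengths positive and less than 1/2. *)
Definition admissible (R : realType) (tau a b c : R) :=
  [/\ a + b + c = 1, a < tau, b < tau, c < tau & tau <= 2^-1].

(** The working form of a flip: the integers n and k record which lifts of the
point and of its image are used, the rest being linear arithmetic. *)
Lemma flips_onE (R : realType) (F : circle R -> circle R) (n k : int)
    (tau u v x y : R) :
  flips_on F tau u v -> u < x + n%:~R < v ->
  y = u + v - x + tau + k%:~R -> F (circ x) = circ y.
Proof.
move=> fl uxv ->.
have -> : circ x = circ (x + n%:~R) :> circle R.
  by apply/esym; exact: (@circ_shift _ n).
rewrite fl //; apply: (@circ_shift _ (- n - k)).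
by rewrite intrB mulrNz; lra.
Qed.

Lemma flips_on_shift (R : realType) (F : circle R -> circle R) (n : int)
    (tau u v u' v' : R) :
  u' = u + n%:~R -> v' = v + n%:~R ->
  flips_on F tau u v -> flips_on F tau u' v'.
Proof.
move=> -> -> fl x xuv; apply: (@flips_onE _ _ (- n) (n + n) _ _ _ _ _ fl).
  by rewrite mulrNz; lra.
by rewrite intrD; lra.
Qed.

Lemma three_flips_rot (R : realType) (F : circle R -> circle R)
    (tau o a b c : R) :
  a + b + c = 1 -> three_flips F tau o a b c -> three_flips F tau (o + a) b c a.
Proof.
move=> abc [fa fb fc]; split=> //.
by apply: (flips_on_shift (n := 1)) fa; lra.
Qed.

Lemma three_flips_shift (R : realType) (F : circle R -> circle R) (n : int)
    (tau o o' a b c : R) :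
  o' = o + n%:~R -> three_flips F tau o a b c -> three_flips F tau o' a b c.
Proof.
move=> -> [fa fb fc].
by split; [move: fa|move: fb|move: fc]; apply: (flips_on_shift (n := n)); lra.
Qed.

Lemma ord3P (P : 'I_3 -> Prop) : P j1 -> P j2 -> P j3 -> forall j, P j.
Proof.
move=> P1 P2 P3 [[|[|[|//]]] lt3].
- by rewrite (_ : Ordinal lt3 = j1)//; apply: val_inj.
- by rewrite (_ : Ordinal lt3 = j2)//; apply: val_inj.
- by rewrite (_ : Ordinal lt3 = j3)//; apply: val_inj.
Qed.

Lemma sum3 (R : realType) (f : 'I_3 -> R) : \sum_j f j = f j1 + f j2 + f j3.
Proof.
rewrite !big_ord_recr big_ord0 /= add0r.
by congr (f _ + f _ + f _); apply: val_inj.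
Qed.

Lemma cutE (R : realType) (l : 'I_3 -> R) :
  [/\ cut l j1 = 0, cut l j2 = l j1 & cut l j3 = l j1 + l j2].
Proof. by rewrite /cut; split; rewrite big_mkcond sum3 /=; lra. Qed.

Lemma flipped_exchangeP (R : realType) (l : 'I_3 -> R) (tau : R)
    (F : circle R -> circle R) :
  flipped_exchange l tau F <-> three_flips F tau 0 (l j1) (l j2) (l j3).
Proof.
have [c1 c2 c3] := cutE l; split=> [fl|[f1 f2 f3]].
  split=> x xj.
  - by rewrite (fl j1) c1 ?circD; [congr circ; lra|lra].
  - by rewrite (fl j2) c2 ?circD; [congr circ; lra|lra].
  - by rewrite (fl j3) c3 ?circD; [congr circ; lra|lra].
apply: ord3P => x; rewrite ?c1 ?c2 ?c3 circD => xj.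
- by rewrite f1; [congr circ; lra|lra].
- by rewrite f2; [congr circ; lra|lra].
- by rewrite f3; [congr circ; lra|lra].
Qed.

Lemma exists_three_flips (R : realType) (tau o a b c : R) :
  0 <= a -> 0 <= b -> 0 <= c -> a + b + c = 1 ->
  exists F : circle R -> circle R, three_flips F tau o a b c.
Proof.
move=> a0 b0 c0 abc.
pose f (x : R) := if x < a then a - x else
  if x < a + b then a + a + b - x else a + a + b + b + c - x.
exists (fun p => circ (o + f (unit_coord (p - circ o)) + tau)).
split=> x ox; rewrite circB circK; [|lra| |lra| |lra]; congr circ;
  rewrite /f.
- by rewrite ifT; lra.
- by rewrite ifF ?ifT; [lra|lra|apply/negbTE; rewrite -leNgt; lra].
- by rewrite !ifF; [lra|apply/negbTE; rewrite -leNgt; lra..].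
Qed.

(** * The first return map *)

(** The arc a is flipped into the arc c when the point lies within tau - b of
the origin, and conversely from the other side; the composition of two flips
is a translation, here by b up to sign. *)
Lemma square_translates (R : realType) (F : circle R -> circle R)
    (tau o a b c : R) :
  admissible tau a b c -> three_flips F tau o a b c ->
  (forall x, o < x < o + tau - b -> F (F (circ x)) = circ (x + b)) /\
  (forall x, o - (1 - b - tau) < x < o -> F (F (circ x)) = circ (x - b)).
Proof.
move=> [abc at_ bt ct t2] [fa fb fc]; split=> x ox.
  rewrite (@flips_onE _ _ 0 0 _ _ _ _ (2 * o + a - x + tau) fa); [|lra|lra].
  by rewrite (@flips_onE _ _ 0 (-1) _ _ _ _ (x + b) fc); [|lra|lra].
rewrite (@flips_onE _ _ 1 (-1) _ _ _ _ (2 * o + a + b - x + tau) fc);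
  [|lra|lra].
by rewrite (@flips_onE _ _ (-1) 0 _ _ _ _ (x - b) fa); [|lra|lra].
Qed.

Lemma return_time_unique (T : Type) (A : set T) (F : T -> T) (p : T) m n :
  return_time A F p m -> return_time A F p n -> m = n.
Proof.
move=> [m0 Am mm] [n0 An nn]; case: (ltngtP m n) => // mn.
  by case: (nn m) => //; rewrite m0.
by case: (mm n) => //; rewrite n0.
Qed.

Lemma first_returnE (T : Type) (A : set T) (F : T -> T) (p : T) n :
  return_time A F p n -> first_return A F p = iter n F p.
Proof.
move=> rn; rewrite /first_return; congr (iter _ F p).
by apply: xget_unique => // m rm; exact: return_time_unique rm rn.
Qed.

(** A point near the origin returns at once. A point farther away is sent by F
into the removed arc, of radius b around o + tau; its image by F^2 is a
translate by b, which still lies in the removed arc but inside the flipped arc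
b, whence the third step returns to S. The images are lifted to S itself. *)
Lemma return_times (R : realType) (F : circle R -> circle R)
    (tau o a b c : R) :
  admissible tau a b c -> b <= a -> b <= c -> three_flips F tau o a b c ->
  let returns n x y :=
    return_time (open_arc (o - (1 - b - tau)) (o + tau - b)) F (circ x) n /\
    iter n F (circ x) = circ y in
  [/\ forall x, o < x < o + (a - b) -> returns 1%N x (2 * o + a + tau - x - 1),
      forall x, o + (a - b) < x < o + tau - b ->
        returns 3%N x (2 * o + 2 * a + tau - x - 1),
      forall x, o - (c - b) < x < o -> returns 1%N x (2 * o + tau - c - x) &
      forall x, o - (1 - b - tau) < x < o - (c - b) ->
        returns 3%N x (2 * o + 2 * a + 2 * b + tau - 2 - x)].
Proof.
move=> adm ba bc fl.
have [Tp Tm] := square_translates adm fl.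
case: adm fl => [abc at_ bt ct t2] [fa fb fc] returns.
have returns1 x y : F (circ x) = circ y ->
    o - (1 - b - tau) < y < o + tau - b -> returns 1%N x y.
  move=> Fx yS; split=> //; split=> //; last by case=> [|[]].
  by rewrite /= Fx; apply: (@in_arc _ 0); lra.
have returns3 x y z w : F (circ x) = circ y -> F (F (circ x)) = circ z ->
    F (circ z) = circ w ->
    o + tau - b <= y <= o + tau + b -> o + tau - b <= z <= o + tau + b ->
    o - (1 - b - tau) < w < o + tau - b -> returns 3%N x w.
  move=> Fx Fy Fz yS zS wS; split; last by rewrite /= Fy Fz.
  split=> //; first by rewrite /= Fy Fz; apply: (@in_arc _ 0); lra.
  case=> [|[|[|[]]]]//= _; first by rewrite Fx; apply: notin_arc; lra.
  by rewrite Fy; apply: notin_arc; lra.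
split=> x ox.
- apply: returns1; last lra.
  by apply: (@flips_onE _ _ 0 (-1) _ _ _ _ _ fa); lra.
- apply: (@returns3 _ (2 * o + a + tau - x) (x + b)); [| | |lra|lra|lra].
  + by apply: (@flips_onE _ _ 0 0 _ _ _ _ _ fa); lra.
  + by apply: Tp; lra.
  + by apply: (@flips_onE _ _ 0 (-1) _ _ _ _ _ fb); lra.
- apply: returns1; last lra.
  by apply: (@flips_onE _ _ 1 (-2) _ _ _ _ _ fc); lra.
- apply: (@returns3 _ (2 * o + a + b + tau - x - 1) (x - b + 1)).
  + by apply: (@flips_onE _ _ 1 (-2) _ _ _ _ _ fc); lra.
  + by rewrite Tm; [apply: (@circ_shift _ (-1)); lra|lra].
  + by apply: (@flips_onE _ _ 0 (-1) _ _ _ _ _ fb); lra.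
  + lra.
  + lra.
  + lra.
Qed.

(** * The renormalized exchange *)

Lemma renormalizationE (R : realType) (F : circle R -> circle R)
    (s L z w : R) :
  0 < L <= 1 -> 0 <= z < 1 -> 0 <= L * w < L ->
  first_return (open_arc s (s + L)) F (circ (s + L * z)) = circ (s + L * w) ->
  renormalization s (s + L) F (circ z) = circ w.
Proof.
move=> L01 z01 w01 ret; rewrite /renormalization /= /glue_arc circK//.
rewrite (_ : s + L - s = L); last lra.
rewrite ret /unglue_arc circB circK; last lra.
by congr circ; rewrite (_ : s + L - s = L); [field|]; lra.
Qed.

Lemma finite_off_points (R : realType) (o : R) (s : seq R)
    (P : circle R -> Prop) :
  (forall x, o <= x < o + 1 -> x \notin s -> ~ P (circ x)) ->
  finite_set [set p | P p].
Proof.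
move=> sP; apply: (@sub_finite_set _ _ (@circ R @` [set` s])); last first.
  exact/finite_image/finite_seq.
move=> p /= Pp; have [x xo xp] := circ_turn o p.
exists x => //=; apply/negPn/negP => xs.
by apply: (sP x) => //; rewrite xp.
Qed.

(** The scaled quantities enter only through their products with L, so that all
the verifications are linear. In the chart the origin is o'; the points at
distance c' before o' and a' after o' are where the return time jumps, and the
flipped arc of length b' runs from the latter, through the glued endpoints of
S, to the former one turn later. *)
Lemma renormalization_flips (R : realType) (F : circle R -> circle R)
    (tau o a b c L tau' o' a' b' c' : R) :
  admissible tau a b c -> b <= a -> b <= c -> three_flips F tau o a b c ->
  L = 1 - 2 * b -> L * tau' = tau - b -> L * o' = 1 - b - tau ->
  L * a' = a - b -> L * b' = b -> L * c' = c - b ->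
  exists F', three_flips F' tau' o' a' b' c' /\
    let s := o - (1 - b - tau) in
    finite_set [set p | renormalization s (s + L) F p <> F' p].
Proof.
move=> adm ba bc fl LE LT LO LA LB LC.
have [r1 r3 r1' r3'] := return_times adm ba bc fl.
case: adm => [abc at_ bt ct t2].
have L0 : 0 < L by lra.
have Lle x y : (x <= y) = (L * x <= L * y) by rewrite ler_pM2l.
have Llt x y : (x < y) = (L * x < L * y) by rewrite ltr_pM2l.
have Leq x y : L * x = L * y -> x = y by apply: mulfI; lra.
have [||||F' fl'] := @exists_three_flips _ tau' o' a' b' c'.
- by rewrite Lle; lra.
- by rewrite Lle; lra.
- by rewrite Lle; lra.
- by apply: Leq; lra.
exists F'; split=> // s; case: fl' => fa fb fc.
have sE : s = o - (1 - b - tau) by [].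
have sL : s + L = o + tau - b by lra.
rewrite -sE -sL in r1 r3 r1' r3'; clearbody s.
(* The value at z of the flip of (u, v), lifted to S by the integer k. *)
pose w u v k z : R := u + v - z + tau' + k%:~R.
have renE n k m u v z y : flips_on F' tau' u v ->
    0 < z < 1 -> L * u < L * (z + m%:~R) < L * v ->
    return_time (open_arc s (s + L)) F (circ (s + L * z)) n /\
      iter n F (circ (s + L * z)) = circ y ->
    y = s + L * w u v k z -> s <= y < s + L ->
    renormalization s (s + L) F (circ z) = F' (circ z).
  move=> fuv z01 zuv [rt it] yw ys.
  rewrite (@flips_onE _ _ m k _ _ _ _ (w u v k z) fuv)//; last first.
    by rewrite (Llt u) (Llt _ v).
  by apply: renormalizationE; [lra|lra|lra|rewrite (first_returnE rt) it yw].
apply: (@finite_off_points _ 0 [:: 0; o' - c'; o'; o' + a']) => z.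
rewrite !inE !negb_or add0r => z01 /and4P[z0 zc zo za]; apply.
have {z0}z01 : 0 < z < 1 by move: z01 z0; lra.
have Lz : 0 < L * z < L by move: z01; rewrite (Llt 0) (Llt _ 1); lra.
case: (ltgtP z (o' - c')) zc => // zc _; rewrite Llt in zc.
  by apply: (renE 3%N (-2) 1 _ _ _ _ fb); [lra|lra|
    by apply: r3'; lra|rewrite /w; lra|lra].
case: (ltgtP z o') zo => // zo _; rewrite Llt in zo.
  by apply: (renE 1%N (-2) 1 _ _ _ _ fc); [lra|lra|
    by apply: r1'; lra|rewrite /w; lra|lra].
case: (ltgtP z (o' + a')) za => // za _; rewrite Llt in za.
  by apply: (renE 1%N (-1) 0 _ _ _ _ fa); [lra|lra|
    by apply: r1; lra|rewrite /w; lra|lra].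
by apply: (renE 3%N (-1) 0 _ _ _ _ fb); [lra|lra|
    by apply: r3; lra|rewrite /w; lra|lra].
Qed.

(** * Arcs of period two *)

Definition flips_pieces (R : realType) (F : circle R -> circle R)
    (l : 'I_3 -> R) (tau o : R) :=
  forall j, flips_on F tau (o + cut l j) (o + cut l j + l j).

Lemma three_flips_pieces (R : realType) (F : circle R -> circle R)
    (l : 'I_3 -> R) (tau o : R) :
  three_flips F tau o (l j1) (l j2) (l j3) -> flips_pieces F l tau o.
Proof.
have [c1 c2 c3] := cutE l.
by case=> f1 f2 f3; apply: ord3P; rewrite ?c1 ?c2 ?c3 ?addr0 ?addrA.
Qed.

(** Conjugating by a rotation amounts to choosing a real lift o of the origin. *)
Lemma in_CET3P (R : realType) (l : 'I_3 -> R) (tau : R)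
    (G : circle R -> circle R) :
  in_CET3 l tau G <-> exists o F,
    flips_pieces F l tau o /\ finite_set [set p | G p <> F p].
Proof.
split=> [[p0 [F [fl fin]]]|[o [F [fl fin]]]].
  exists (repr p0), (fun p => p0 + F (p - p0)); split=> // j x xj.
  rewrite -{1 2}[p0]circ_reprK circB (fl j); last lra.
  by rewrite !circD; congr circ; lra.
exists (circ o), (fun p => F (p + circ o) - circ o); split.
  by move=> j x xj; rewrite circD (fl j) ?circB ?circD; [congr circ; lra|lra].
apply: sub_finite_set fin => p /=.
by rewrite addrNK addrC addrNK.
Qed.

(** A flip has isolated fixed points: two fixed points at distance d < 1/2 would
give an integer 2 d strictly between 0 and 1. *)
Lemma flip_not_identity (R : realType) (F G : circle R -> circle R)
    (tau u v u1 v1 : R) (I : set (circle R)) :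
  flips_on F tau u v -> u <= u1 -> u1 < v1 -> v1 <= v ->
  finite_set [set p | G p <> F p] -> open_arc u1 v1 `<=` I ->
  ~ id_off_finite G I.
Proof.
move=> fl uu1 uv vv1 fin uvI idG.
have finD : finite_set ([set p | G p <> F p] `|` [set p | I p /\ G p <> p]).
  by rewrite finite_setU.
have [u' [v' [uu uv' vv avoid]]] := subarc_avoiding finD uv.
have fixed x : u' < x < v' -> exists n : int, u + v - x + tau - x = n%:~R.
  move=> xuv; apply/circ_eqP; rewrite -fl; last lra.
  apply: contrapT => Fx; apply: (avoid x) => //.
  have [Gx|] := pselect (G (circ x) = F (circ x)); last by left.
  by right; split; [apply: uvI; exists x => //=; lra|rewrite Gx].
pose d := Num.min (v' - u') 1 / 3.
have d0 : 0 < d by rewrite divr_gt0 // lt_min; lra.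
have d3 : 3 * d <= v' - u' /\ 3 * d <= 1.
  rewrite /d [3 * _]mulrC divfK ?pnatr_eq0//.
  by rewrite !ge_min !lexx orbT.
have [|n en] := fixed (u' + d); first lra.
have [|m em] := fixed (u' + 2 * d); first lra.
have nm : (n - m)%:~R = 2 * d :> R by rewrite intrB -en -em; lra.
have nm0 : n - m = 0 by apply: (@int_small R); lra.
by move: nm; rewrite nm0; lra.
Qed.

(** Flipping (u, v) and then rotating maps the arc (u + tau, v) onto itself. *)
Lemma two_periodic_of_long_piece (R : realType) (F G : circle R -> circle R)
    (tau u v : R) :
  0 <= tau < v - u -> v <= u + 1 -> flips_on F tau u v ->
  finite_set [set p | G p <> F p] ->
  exists I, periodic_interval 2 G I.
Proof.
move=> tuv vu fl fin; exists (open_arc (u + tau) v).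
have flI x : u + tau < x < v ->
    F (circ x) = circ (u + v - x + tau) /\ F (F (circ x)) = circ x.
  move=> xuv; rewrite !fl; [|lra..].
  by split=> //; congr circ; lra.
split=> //.
- by exists (u + tau), v; split=> //; lra.
- apply: (@sub_finite_set _ _ ([set p | G p <> F p] `|`
    F @` [set p | G p <> F p])); last first.
    by rewrite finite_setU; split=> //; exact: finite_image.
  move=> _ [[x /= xuv <-]] GGx; have [Fx FFx] := flI x xuv.
  have [Gx|] := pselect (G (circ x) = F (circ x)); last by left.
  right; exists (F (circ x)) => //=; rewrite -Gx => GFx.
  by apply: GGx; rewrite GFx Gx.
- case=> [|[|m]]//= _; apply: (@flip_not_identity _ F _ _ _ _ (u + tau) v) fin _;
    [exact: fl|lra|lra|lra|by []].
Qed.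

Lemma piece_of (R : realType) (l : 'I_3 -> R) (o x : R) :
  simplex l -> (forall j, circ x <> circ (o + cut l j)) ->
  exists j (n : int), o + cut l j < x + n%:~R < o + cut l j + l j.
Proof.
have [c1 c2 c3] := cutE l; rewrite /simplex sum3 => -[_ l1] xe.
have [y yo /esym xy] := circ_turn o (circ x).
have [n yx] := (circ_eqP _ _).1 (esym xy).
have ye j : y <> o + cut l j by move=> yj; apply: (xe j); rewrite xy yj.
have := (ye j1, ye j2, ye j3); rewrite c1 c2 c3 => -[[y1 y2] y3].
have yE : x + n%:~R = y by rewrite -yx addrC subrK.
have [lt1|ge1] := ltP y (o + l j1).
  exists j1, n; rewrite c1 yE; lra.
have [lt2|ge2] := ltP y (o + l j1 + l j2).
  exists j2, n; rewrite c2 yE; lra.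
by exists j3, n; rewrite c3 yE; lra.
Qed.

(** An integral length is 0, or it is 1 and the other lengths are 0. *)
Lemma zero_of_integral (R : realType) (l : 'I_3 -> R) (j : 'I_3) (n : int) :
  simplex l -> l j = n%:~R -> exists i, l i = 0.
Proof.
move=> [l0]; rewrite sum3 => l1 ln.
have [lj1|lj1] := ltP (l j) 1.
  exists j; rewrite ln (_ : n = 0)//; apply: (@int_small R).
  by rewrite -ln; have := l0 j; lra.
have := (l0 j1, l0 j2, l0 j3) => -[[p1 p2] p3].
by elim/ord3P: j ln lj1 => _ lj; [exists j2|exists j1|exists j1]; lra.
Qed.

(** Two distinct pieces are adjacent on one side or the other, so twice the
distance of their midpoints is congruent, up to sign, to the third length
modulo 1. *)
Lemma midpoints_congruent (R : realType) (l : 'I_3 -> R) (i k : 'I_3)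
    (z : int) :
  simplex l -> i != k ->
  (2 * cut l k + l k) - (2 * cut l i + l i) = z%:~R -> exists j, l j = 0.
Proof.
move=> sl; have [c1 c2 c3] := cutE l; have [_] := sl; rewrite sum3 => l1.
have third j (m : int) : l j = m%:~R -> exists i, l i = 0.
  exact: zero_of_integral.
move: i k; apply: ord3P; apply: ord3P => //; rewrite ?c1 ?c2 ?c3 => _ mid.
- by apply: (third j3 (1 - z)); rewrite intrB -mid; lra.
- by apply: (third j2 (z - 1)); rewrite intrB -mid; lra.
- by apply: (third j3 (1 + z)); rewrite intrD -mid; lra.
- by apply: (third j1 (1 - z)); rewrite intrB -mid; lra.
- by apply: (third j2 (- z - 1)); rewrite intrB mulrNz -mid; lra.
- by apply: (third j1 (1 + z)); rewrite intrD -mid; lra.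
Qed.

(** The reflection of x in its piece and y are two points of the same piece that
differ by tau modulo 1. When the integer part is negative the difference is at
least 1 - tau, which is at least tau. *)
Lemma overlap_length (R : realType) (u len tau x y : R) (n m : int) :
  0 <= tau <= 2^-1 -> u < x + n%:~R < u + len -> u < y + m%:~R < u + len ->
  y = 2 * u + len + tau - n%:~R - x -> tau < len.
Proof.
move=> t2 xu yu yE; have [m0|m0] := lerP (0 : R) m%:~R; first lra.
have m1 : m%:~R <= -1 :> R.
  by rewrite (ler_int R m (-1)); move: m0; rewrite ltrz0; lia.
lra.
Qed.

(** Shrink I to an arc (u2, v2) inside one piece i, off the exceptional points;
then shrink its image (w - v2, w - u2) in the same way. A point y found there
and its preimage x = w - y are both generic, so the orbit x, y, x can be
computed with the flips of the pieces i and k that contain x and y. *)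
Lemma two_periodic_cases (R : realType) (F G : circle R -> circle R)
    (l : 'I_3 -> R) (tau o : R) (I : set (circle R)) :
  simplex l -> 0 <= tau <= 2^-1 -> flips_pieces F l tau o ->
  finite_set [set p | G p <> F p] -> periodic_interval 2 G I ->
  (exists i, tau < l i) \/ (exists i, l i = 0).
Proof.
move=> sl tau2 fl fin [[u [v [uv _ IE]]] _ per _].
pose E := [set circ (o + cut l j) | j in [set: 'I_3]].
have finD : finite_set ([set p | G p <> F p] `|` E).
  by rewrite finite_setU; split=> //; exact/finite_image/finite_finset.
have finD' : finite_set
    ([set p | I p /\ iter 2 G p <> p] `|` ([set p | G p <> F p] `|` E)).
  by rewrite finite_setU.
have piece x : ~ E (circ x) ->
    exists j (n : int), o + cut l j < x + n%:~R < o + cut l j + l j.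
  by move=> xE; apply: piece_of => // j xj; apply: xE; exists j.
have [u1 [v1 [uu1 uv1 vv1 avoid1]]] := subarc_avoiding finD' uv.
have [|i [n xi]] := piece ((u1 + v1) / 2).
  by move=> xE; apply: (avoid1 ((u1 + v1) / 2)); [lra|right; right].
pose u2 := Num.max u1 (o + cut l i - n%:~R).
pose v2 := Num.min v1 (o + cut l i + l i - n%:~R).
have [u21 u2i] : u1 <= u2 /\ o + cut l i - n%:~R <= u2.
  by rewrite !le_max !lexx orbT.
have [v21 v2i] : v2 <= v1 /\ v2 <= o + cut l i + l i - n%:~R.
  by rewrite !ge_min !lexx orbT.
have uv2 : u2 < v2 by rewrite gt_max !lt_min; lra.
pose w := 2 * (o + cut l i) + l i + tau - n%:~R.
have wuv : w - v2 < w - u2 by lra.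
have [u3 [v3 [uu3 uv3 vv3 avoid3]]] := subarc_avoiding finD wuv.
pose y := (u3 + v3) / 2; pose x := w - y.
have y3 : u3 < y < v3 by rewrite /y; lra.
have x2 : u2 < x < v2 by rewrite /x; lra.
have [|k [m yk]] := piece y.
  by move=> yE; apply: (avoid3 y y3); right.
have Fx : F (circ x) = circ y.
  by apply: (@flips_onE _ _ n (- n) _ _ _ _ _ (fl i));
    [lra|rewrite mulrNz /x /w; lra].
have Fy : F (circ y) = circ (2 * (o + cut l k) + l k - y + tau).
  by apply: (@flips_onE _ _ m 0 _ _ _ _ _ (fl k)); lra.
have Gx : G (circ x) = circ y.
  rewrite -Fx; apply: contrapT => Gx; apply: (avoid1 x); first lra.
  by right; left.
have Gy : G (circ y) = F (circ y).
  by apply: contrapT => Gy; apply: (avoid3 y y3); left.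
have GGx : G (G (circ x)) = circ x.
  apply: contrapT => GGx; apply: (avoid1 x); first lra.
  by left; split=> //; rewrite IE; exists x => //=; lra.
move: GGx; rewrite Gx Gy Fy => /circ_eqP[q xq].
have {xq} mid : (2 * cut l k + l k) - (2 * cut l i + l i) = (q - n)%:~R :> R.
  by rewrite intrB -xq /x /w; lra.
have [ik|ik] := eqVneq i k.
  left; exists i; apply: (@overlap_length _ (o + cut l i) _ _ x y n m) => //.
  - lra.
  - by rewrite ik; lra.
  - by rewrite /x /w; lra.
by right; exact: midpoints_congruent sl ik mid.
Qed.

(** * Subdivisions of a turn and jumps *)

Lemma subdivision_le (R : realType) (e : nat -> R) (n : nat) :
  (forall i, (i < n)%N -> e i < e i.+1) ->
  forall i j, (i <= j <= n)%N -> e i <= e j.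
Proof.
move=> einc i; elim=> [|j IH] /andP[ij jn].
  by move: ij; rewrite leqn0 => /eqP->.
move: ij; rewrite leq_eqVlt => /orP[/eqP<-//|ij].
by apply: (le_trans (IH _)); [rewrite -ltnS ij ltnW|exact/ltW/einc].
Qed.

Lemma subdivision_trivIset (R : realType) (K : Type) (A : K -> set (circle R))
    (e : nat -> R) (n : nat) (pos : K -> nat) :
  (forall i, (i < n)%N -> e i < e i.+1) -> e n = e 0%N + 1 ->
  injective pos -> (forall k, (pos k < n)%N) ->
  (forall k, A k = open_arc (e (pos k)) (e (pos k).+1)) ->
  trivIset setT A.
Proof.
move=> einc en pinj pn AE k k' _ _; rewrite !AE.
move=> [_ [[x /= xk <-] [y /= yk yx]]]; apply: pinj.
have le := subdivision_le einc.
have xe : e 0%N <= e (pos k) /\ e (pos k).+1 <= e n.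
  by split; apply: le; rewrite ?leq0n ?leqnn ?pn // ltnW.
have ye : e 0%N <= e (pos k') /\ e (pos k').+1 <= e n.
  by split; apply: le; rewrite ?leq0n ?leqnn ?pn // ltnW.
have {yx} yx : y = x by apply: circ_inj yx; lra.
case: (ltngtP (pos k) (pos k')) => // kk; exfalso.
  have : e (pos k).+1 <= e (pos k') by apply: le; rewrite kk (ltnW (pn _)).
  lra.
have : e (pos k').+1 <= e (pos k) by apply: le; rewrite kk (ltnW (pn _)).
lra.
Qed.

(** The half-open arcs of the subdivision cover the turn, so only the division
points are missed. *)
Lemma subdivision_complement (R : realType) (K : Type)
    (A : K -> set (circle R)) (e : nat -> R) (n : nat) (pos : K -> nat) :
  e n = e 0%N + 1 -> (forall i, (i < n)%N -> exists k, pos k = i) ->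
  (forall k, A k = open_arc (e (pos k)) (e (pos k).+1)) ->
  forall p, ~ (\bigcup_k A k) p -> exists2 i, (i < n)%N & p = circ (e i).
Proof.
move=> en psurj AE p pA; have [x xe xp] := circ_turn (e 0%N) p.
have [i ilt xi] : exists2 i, (i < n)%N & e i <= x < e i.+1.
  have : e 0%N <= x < e n by lra.
  elim: n {en psurj xe xp} => [|n IH] xe.
    by case/andP: xe => /le_lt_trans h /h; rewrite ltxx.
  have [xn|xn] := ltP x (e n); last by exists n => //; lra.
  by have [|i ilt xi] := IH _; [lra|exists i => //; exact: ltnW].
have [ix|ix] := eqVneq (e i) x; first by exists i; rewrite // ix.
have [k ki] := psurj i ilt; case: pA; exists k => //; rewrite AE ki -xp.
by exists x => //=; move: ix xi; lra.
Qed.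

Definition translates_on (R : realType) (T : circle R -> circle R)
    (t u v : R) :=
  forall x, u < x < v -> T (circ x) = circ (x + t).

Lemma translates_on_shift (R : realType) (T : circle R -> circle R) (n : int)
    (t u v u' v' : R) :
  u' = u + n%:~R -> v' = v + n%:~R ->
  translates_on T t u v -> translates_on T t u' v'.
Proof.
move=> -> -> tr x xuv; rewrite (@circ_shift _ n _ (x - n%:~R)); last lra.
by rewrite tr; [apply: (@circ_shift _ (- n)); rewrite mulrNz; lra|lra].
Qed.

Lemma image_translates (R : realType) (T : circle R -> circle R) (t u v : R) :
  translates_on T t u v -> T @` open_arc u v = open_arc (u + t) (v + t).
Proof.
move=> tr; apply/seteqP; split=> [_ [_ [x /= xuv <-] <-]|_ [x /= xuv <-]].
  by rewrite tr//; exists (x + t) => //=; lra.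
exists (circ (x - t)); first by exists (x - t) => //=; lra.
by rewrite tr; [rewrite subrK|lra].
Qed.

(** Continuity at w would force both one-sided translations to give the same
point, whatever value T takes there. *)
Lemma jump_discontinuous (R : realType) (T : circle R -> circle R)
    (t t' u w v : R) :
  translates_on T t u w -> translates_on T t' w v -> u < w < v ->
  -1 < t - t' < 1 -> t != t' -> ~ {for circ w, continuous T}.
Proof.
move=> tu tv uwv tt /eqP ne cont; apply: ne.
have Tl : T (circ w) = circ (w + t).
  apply: continuous_translation => // e e0.
  pose d := Num.min e (w - u) / 2.
  have d0 : 0 < d by rewrite divr_gt0// lt_min; lra.
  have [de dw] : 2 * d <= e /\ 2 * d <= w - u.
    by rewrite /d [2 * _]mulrC divfK ?pnatr_eq0// !ge_min !lexx orbT.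
  by exists (- d); [lra|rewrite tu; [congr circ; lra|lra]].
have Tr : T (circ w) = circ (w + t').
  apply: continuous_translation => // e e0.
  pose d := Num.min e (v - w) / 2.
  have d0 : 0 < d by rewrite divr_gt0// lt_min; lra.
  have [de dw] : 2 * d <= e /\ 2 * d <= v - w.
    by rewrite /d [2 * _]mulrC divfK ?pnatr_eq0// !ge_min !lexx orbT.
  by exists d; [lra|rewrite tv; [congr circ; lra|lra]].
have := circ_inj _ (etrans (esym Tl) Tr); lra.
Qed.

Lemma ordS3 : [/\ ordS j1 = j2, ordS j2 = j3 & ordS j3 = j1].
Proof. by split; apply: val_inj. Qed.

Lemma ord_pred3 : [/\ ord_pred j1 = j3, ord_pred j2 = j1 & ord_pred j3 = j2].
Proof. by split; apply: val_inj. Qed.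

(** * The six arcs *)

(** The lift of the common endpoint of I_j^+ and I_j^- that ends I_j^+ in
[bounds]. It is the point where the two intervals other than I_j meet. *)
Definition center (R : realType) (l : 'I_3 -> R) (j : 'I_3) : R :=
  match val j with 0%N => l j1 + l j2 | 1%N => 1 | _ => l j1 end.

(** Read from the center of S_j, the three pieces come in the cyclic order
predecessor of j, j, successor of j. *)
Lemma three_flips_center (R : realType) (F : circle R -> circle R)
    (l : 'I_3 -> R) (tau : R) (j : 'I_3) :
  simplex l -> flipped_exchange l tau F ->
  three_flips F tau (center l j) (l (ord_pred j)) (l j) (l (ordS j)).
Proof.
rewrite /simplex sum3 => -[_ l1] /flipped_exchangeP fl.
have [S1 S2 S3] := ordS3; have [P1 P2 P3] := ord_pred3.
have fl' := three_flips_rot l1 fl.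
have [l1' fl''] : l j2 + l j3 + l j1 = 1 /\
    three_flips F tau (0 + l j1 + l j2) (l j3) (l j1) (l j2).
  by split; [lra|apply: three_flips_rot fl'; lra].
move: j; apply: ord3P; rewrite /center /= ?S1 ?S2 ?S3 ?P1 ?P2 ?P3.
- by apply: (three_flips_shift (n := 0)) fl''; lra.
- by apply: (three_flips_shift (n := 1)) fl; lra.
- by apply: (three_flips_shift (n := 0)) fl'; lra.
Qed.

Lemma flips_pieces_center (R : realType) (F : circle R -> circle R)
    (l : 'I_3 -> R) (tau o : R) (j : 'I_3) :
  \sum_i l i = 1 ->
  three_flips F tau o (l (ord_pred j)) (l j) (l (ordS j)) ->
  exists o', flips_pieces F l tau o'.
Proof.
rewrite sum3 => l1.
have [S1 S2 S3] := ordS3; have [P1 P2 P3] := ord_pred3.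
move: j; apply: ord3P; rewrite ?S1 ?S2 ?S3 ?P1 ?P2 ?P3 => fl.
- exists (o + l j3); apply: three_flips_pieces.
  by apply: three_flips_rot fl; lra.
- by exists o; apply: three_flips_pieces.
- exists (o + l j2 + l j3); apply: three_flips_pieces.
  by apply: three_flips_rot; [lra|apply: three_flips_rot fl; lra].
Qed.

(** The integer is -1 for the second index only, where I_j^+ ends at 1 and I_j^-
starts at 0. *)
Lemma bounds_center (R : realType) (l : 'I_3 -> R) (tau : R) (j : 'I_3) :
  \sum_i l i = 1 ->
  bounds l tau j true = (center l j - (1 - l j - tau), center l j) /\
  exists n : int, bounds l tau j false =
    (center l j + n%:~R, center l j + (tau - l j) + n%:~R).
Proof.
rewrite sum3 => l1; move: j.
by apply: ord3P; rewrite /bounds /center /=;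
  (split; first by congr (_, _); lra);
  [exists 0|exists (-1)|exists 0]; congr (_, _); lra.
Qed.

Lemma admissible_neighbours (R : realType) (l : 'I_3 -> R) (tau : R)
    (j : 'I_3) :
  simplex l -> tau <= 2^-1 -> (forall j, l j < tau) ->
  admissible tau (l (ord_pred j)) (l j) (l (ordS j)).
Proof.
rewrite /simplex sum3 => -[_ l1] t2 lt; split=> //.
have [S1 S2 S3] := ordS3; have [P1 P2 P3] := ord_pred3.
by move: j; apply: ord3P; rewrite ?S1 ?S2 ?S3 ?P1 ?P2 ?P3; lra.
Qed.

Lemma square_translates_piece (R : realType) (F : circle R -> circle R)
    (l : 'I_3 -> R) (tau : R) (j : 'I_3) (s : bool) :
  simplex l -> tau <= 2^-1 -> (forall j, l j < tau) ->
  flipped_exchange l tau F ->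
  translates_on (F \o F) (if s then - l j else l j)
    (bounds l tau j s).1 (bounds l tau j s).2.
Proof.
move=> sl t2 lt fl; have fj := three_flips_center j sl fl.
have [_ l1] := sl.
have [Tp Tm] := square_translates (admissible_neighbours j sl t2 lt) fj.
have [bt [n bf]] := bounds_center tau j l1.
case: s; first by rewrite bt => x xj; apply: Tm; move: xj => /=; lra.
rewrite bf /=; apply: (translates_on_shift (n := n) (u := center l j)) => //.
by move=> x xj; apply: Tp; lra.
Qed.

(** The order of the six arcs in a turn starting at 0, with the division points
that they determine. *)
Definition piece_rank (k : 'I_3 * bool) : nat :=
  match val k.1, k.2 with
  | 0%N, true => 3
  | 0%N, false => 4
  | 1%N, true => 5
  | 1%N, false => 0
  | _, true => 1
  | _, false => 2
  end.

Definition piece_endpoints (R : realType) (l : 'I_3 -> R) (tau : R) :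
    nat -> R :=
  nth 0 [:: 0; tau - l j2; l j1; l j1 + tau - l j3; l j1 + l j2; l j2 + tau; 1].

(** The order of the six images in a turn starting at l_1 - l_3: each I_j^- and
I_j^+ are exchanged, and the pairs come in the order of their indices. *)
Definition image_rank (k : 'I_3 * bool) : nat := (val k.1).*2 + k.2.

Definition image_endpoints (R : realType) (l : 'I_3 -> R) (tau : R) :
    nat -> R :=
  nth 0 [:: l j1 - l j3; tau - l j3; l j2; tau; 1 - l j2; l j1 + tau;
            l j1 - l j3 + 1].

Lemma piece_rank_inj : injective piece_rank.
Proof.
move=> [j s] [j' s']; move: j j' s s'.
by do 2 apply: ord3P; move=> [] [].
Qed.

Lemma image_rank_inj : injective image_rank.
Proof.
move=> [j s] [j' s']; move: j j' s s'.
by do 2 apply: ord3P; move=> [] [].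
Qed.

(** At a center the translations by - l_j and l_j meet; at the other three
division points the translations by l_i and - l_k with i <> k meet. In all
cases the gap lies strictly between 0 and 1 in absolute value. *)
Lemma square_interval_exchange (R : realType) (F : circle R -> circle R)
    (l : 'I_3 -> R) (tau : R) :
  simplex l -> tau <= 2^-1 -> (forall j, l j < tau) ->
  flipped_exchange l tau F ->
  interval_exchange 6 (F \o F) (fun k : 'I_3 * bool => Ipm l tau k.1 k.2).
Proof.
move=> sl t2 lt fl.
have Ttr j s := @square_translates_piece _ F l tau j s sl t2 lt fl.
have := (lt j1, lt j2, lt j3) => -[[lt1 lt2] lt3].
have [_] := sl; rewrite sum3 => l1.
pose A (k : 'I_3 * bool) := Ipm l tau k.1 k.2.
pose e := piece_endpoints l tau; pose e' := image_endpoints l tau.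
have AE k : A k = open_arc (e (piece_rank k)) (e (piece_rank k).+1).
  by case: k => j s; move: j s; apply: ord3P => -[].
have TAE k : (F \o F) @` A k =
    open_arc (e' (image_rank k)) (e' (image_rank k).+1).
  rewrite (image_translates (Ttr k.1 k.2)); case: k => j s; move: j s.
  by apply: ord3P => -[]; rewrite /e' /image_endpoints /image_rank /bounds /=;
    [apply: (@arc_shift _ 0)|apply: (@arc_shift _ 1)
    |apply: (@arc_shift _ 0)|apply: (@arc_shift _ 0)
    |apply: (@arc_shift _ (-1))|apply: (@arc_shift _ 0)]; lra.
have einc i : (i < 6)%N -> e i < e i.+1.
  by do 6?[case: i => [_|i]] => //; rewrite /e /piece_endpoints /=; lra.
have einc' i : (i < 6)%N -> e' i < e' i.+1.
  by do 6?[case: i => [_|i]] => //; rewrite /e' /image_endpoints /=; lra.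
have e6 : e 6%N = e 0%N + 1 by rewrite /e /piece_endpoints /=; lra.
have rk k : (piece_rank k < 6)%N.
  by case: k => j s; move: j s; apply: ord3P => -[].
have rk' k : (image_rank k < 6)%N.
  by case: k => j s; move: j s; apply: ord3P => -[].
have rks i : (i < 6)%N -> exists k, piece_rank k = i.
  do 6?[case: i => [_|i]] => //; [exists (j2, false)|exists (j3, true)
    |exists (j3, false)|exists (j1, true)|exists (j1, false)|exists (j2, true)];
  by [].
have off p : ~ (\bigcup_k A k) p -> exists2 i, (i < 6)%N & p = circ (e i).
  exact: (subdivision_complement e6 rks AE).
split; first by rewrite card_prod card_ord card_bool.
split.
- move=> k; rewrite -/(A k) AE.
  exists (e (piece_rank k)), (e (piece_rank k).+1); split=> //.
    exact: einc.
  have le := subdivision_le einc.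
  have := le 0%N (piece_rank k); have := le (piece_rank k).+1 6%N.
  rewrite leq0n leqnn rk (ltnW (rk k)) /= => /(_ isT) h1 /(_ isT) h2; lra.
- split; first exact: (subdivision_trivIset einc e6 piece_rank_inj rk AE).
  apply: (@sub_finite_set _ _ [set circ (e i) | i in `I_6]); last first.
    exact/finite_image/finite_II.
  by move=> p /off[i i6 ->]; exists i.
- move=> [j s]; exists (circ (if s then - l j else l j)).
  by move=> _ [x /= xj <-]; rewrite circD; exact: Ttr.
- by apply: (subdivision_trivIset einc' _ image_rank_inj rk' TAE).
- have len j s : (bounds l tau j s).1 < (bounds l tau j s).2.
    by move: j s; apply: ord3P => -[]; rewrite /bounds /=; lra.
  have jump w k k' (n : int) :
      w = (bounds l tau k.1 k.2).2 + n%:~R -> w = (bounds l tau k'.1 k'.2).1 ->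
      let t := if k.2 then - l k.1 else l k.1 in
      let t' := if k'.2 then - l k'.1 else l k'.1 in
      -1 < t - t' < 1 -> t - t' != 0 -> ~ {for circ w, continuous (F \o F)}.
    move=> wk wk' t t' tt tt0; apply: (jump_discontinuous (t := t) (t' := t')).
    + exact: (translates_on_shift (n := n) erefl wk (Ttr _ _)).
    + by rewrite wk'; exact: Ttr.
    + by have := len k.1 k.2; have := len k'.1 k'.2; lra.
    + by [].
    + by rewrite -subr_eq0.
  (* At 0 the arc on the left is I_2^+, whose bounds end at 1. *)
  move=> p /off[i i6 ->]; do 6?[case: i i6 => [_|i i6]] => //.
  + by apply: (jump _ (j2, true) (j2, false) (-1));
      rewrite /e /piece_endpoints /=; lra.
  + by apply: (jump _ (j2, false) (j3, true) 0);
      rewrite /e /piece_endpoints /=; lra.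
  + by apply: (jump _ (j3, true) (j3, false) 0);
      rewrite /e /piece_endpoints /=; lra.
  + by apply: (jump _ (j3, false) (j1, true) 0);
      rewrite /e /piece_endpoints /=; lra.
  + by apply: (jump _ (j1, true) (j1, false) 0);
      rewrite /e /piece_endpoints /=; lra.
  + by apply: (jump _ (j1, false) (j2, true) 0);
      rewrite /e /piece_endpoints /=; lra.
Qed.

(** * The fully subtractive step *)

Lemma subtract_neighbours (R : realType) (l : 'I_3 -> R) (j : 'I_3) :
  subtract l j (ord_pred j) = l (ord_pred j) - l j /\
  subtract l j (ordS j) = l (ordS j) - l j.
Proof.
have [S1 S2 S3] := ordS3; have [P1 P2 P3] := ord_pred3.
by move: j; apply: ord3P; rewrite ?S1 ?S2 ?S3 ?P1 ?P2 ?P3.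
Qed.

Lemma sum_subtract (R : realType) (l : 'I_3 -> R) (j : 'I_3) :
  \sum_i l i = 1 -> \sum_i subtract l j i = 1 - 2 * l j.
Proof.
rewrite !sum3 => l1; move: j.
by apply: ord3P; rewrite /subtract /=; lra.
Qed.

Lemma third_length (R : realType) (l : 'I_3 -> R) (i j : 'I_3) :
  \sum_k l k = 1 -> i != j -> exists k, l k = 1 - l i - l j.
Proof.
rewrite sum3 => l1; move: i j.
by do 2 apply: ord3P => //; move=> _;
   [exists j3|exists j2|exists j3|exists j1|exists j2|exists j1]; lra.
Qed.

Lemma Ipm_center (R : realType) (l : 'I_3 -> R) (tau : R) (j : 'I_3) :
  \sum_i l i = 1 ->
  Ipm l tau j true = open_arc (center l j - (1 - l j - tau)) (center l j) /\
  Ipm l tau j false = open_arc (center l j) (center l j + (tau - l j)).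
Proof.
move=> l1; have [bt [n bf]] := bounds_center tau j l1.
by rewrite /Ipm bt bf; split=> //; exact: arc_shift.
Qed.

Lemma piece_lengths (R : realType) (l : 'I_3 -> R) (tau : R) (j : 'I_3) :
  \sum_i l i = 1 ->
  Ipm_length l tau j true = 1 - l j - tau /\
  Ipm_length l tau j false = tau - l j.
Proof.
move=> l1; have [bt [n bf]] := bounds_center tau j l1.
by rewrite /Ipm_length bt bf /=; split; lra.
Qed.

Lemma Sj_arc (R : realType) (l : 'I_3 -> R) (tau : R) (j : 'I_3) :
  \sum_i l i = 1 -> tau <= 2^-1 -> l j < tau ->
  Sj l tau j =
  open_arc (center l j - (1 - l j - tau)) (center l j + (tau - l j)).
Proof.
move=> l1 t2 lt; have [It If] := Ipm_center tau j l1.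
have [bt _] := bounds_center tau j l1.
rewrite /Sj It If bt /=; apply/seteqP; split.
  move=> _ [[[x /= xI <-]|[x /= xI <-]]|->].
  - by exists x => //=; lra.
  - by exists x => //=; lra.
  - by exists (center l j) => //=; lra.
move=> _ [x /= xI <-]; have [xo|xo|->] := ltgtP x (center l j).
- by left; left; exists x => //=; lra.
- by left; right; exists x => //=; lra.
- by right.
Qed.

(** Only the center and the two points where the return time jumps may fail to
return. *)
Lemma finite_no_return (R : realType) (F : circle R -> circle R)
    (tau o a b c : R) :
  admissible tau a b c -> b <= a -> b <= c -> three_flips F tau o a b c ->
  let S := open_arc (o - (1 - b - tau)) (o + (tau - b)) in
  finite_set [set p | S p /\ ~ exists n, return_time S F p n].
Proof.
move=> adm ba bc fl S; have [r1 r3 r1' r3'] := return_times adm ba bc fl.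
have SE : S = open_arc (o - (1 - b - tau)) (o + tau - b) by rewrite /S addrA.
rewrite -SE in r1 r3 r1' r3'.
apply: (@finite_off_points _ (o + tau - b - 1)
  [:: o - (c - b); o; o + (a - b)]).
move=> x xo; rewrite !inE !negb_or => /and3P[xc x0 xa].
rewrite {1}/S => -[/arc_circ[n xn]]; apply.
case: adm => abc at_ bt ct t2.
have n0 : n = 0 by apply: (@int_small R); lra.
have {xn n0} xS : o - (1 - b - tau) < x < o + tau - b.
  by move: xn; rewrite n0; lra.
case: (ltgtP x (o - (c - b))) xc => // xc _.
  by exists 3%N; have [] := r3' x; [lra|].
case: (ltgtP x o) x0 => // x0 _.
  by exists 1%N; have [] := r1' x; [lra|].
case: (ltgtP x (o + (a - b))) xa => // xa _.
  by exists 1%N; have [] := r1 x; [lra|].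
by exists 3%N; have [] := r3 x; [lra|].
Qed.

(** Around the center o, the images are (o + l_j, o + tau) and
(o + tau, o + 1 - l_j). *)
Lemma neighbouring_pieces (R : realType) (F : circle R -> circle R)
    (l : 'I_3 -> R) (tau : R) (j : 'I_3) :
  simplex l -> tau <= 2^-1 -> (forall j, l j < tau) ->
  flipped_exchange l tau F ->
  neighbouring (Ipm l tau j true) (Ipm l tau j false) /\
  neighbouring ((F \o F) @` Ipm l tau j true) ((F \o F) @` Ipm l tau j false).
Proof.
move=> sl t2 lt fl; have [_ l1] := sl.
have [It If] := Ipm_center tau j l1.
have [Tp Tm] := square_translates (admissible_neighbours j sl t2 lt)
  (three_flips_center j sl fl).
have lj := lt j; have l0 : 0 <= l j by case: sl.
set o := center l j in It If Tp Tm; rewrite It If; split.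
  exists (o - (1 - l j - tau)), o, (o + (tau - l j)).
  by split; [lra|lra|lra|left].
rewrite (@image_translates _ _ (- l j)); last exact: Tm.
rewrite (@image_translates _ _ (l j)); last by move=> x xo; apply: Tp; lra.
exists (o + l j), (o + tau), (o + 1 - l j); split; [lra|lra|lra|right].
split; first by congr open_arc; lra.
by apply: (@arc_shift _ (-1)); lra.
Qed.

Lemma fully_subtractive_simplex (R : realType) (l : 'I_3 -> R) (j : 'I_3) :
  simplex l -> l j < 2^-1 -> (forall k, l j <= l k) ->
  simplex (fully_subtractive l j).
Proof.
move=> [l0 l1] lj lmin; split=> [k|].
  rewrite /fully_subtractive sum_subtract// divr_ge0//; last lra.
  by rewrite /subtract; case: eqP => // _; have := lmin k; lra.
rewrite -mulr_suml divff// sum_subtract//; lra.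
Qed.

Lemma renormalization_pieces (R : realType) (F : circle R -> circle R)
    (l : 'I_3 -> R) (tau : R) (j : 'I_3) :
  simplex l -> tau <= 2^-1 -> (forall j, l j < tau) ->
  flipped_exchange l tau F -> (forall k, l j <= l k) ->
  exists o F',
    flips_pieces F' (fully_subtractive l j) ((tau - l j) / (1 - 2 * l j)) o /\
    finite_set [set p |
      renormalization (s_minus l tau j) (s_plus l tau j) F p <> F' p].
Proof.
move=> sl t2 lt fl lmin; have [_ l1] := sl.
have lj := lt j; have L0 : 1 - 2 * l j != 0 by apply: lt0r_neq0; lra.
have sl' : simplex (fully_subtractive l j).
  by apply: fully_subtractive_simplex => //; lra.
have [subP subS] := subtract_neighbours l j.
have LM x : (1 - 2 * l j) * (x / (1 - 2 * l j)) = x by rewrite mulrC divfK.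
have LM' k : (1 - 2 * l j) * fully_subtractive l j k = subtract l j k.
  by rewrite /fully_subtractive sum_subtract// LM.
have [F' [fl' fin]] := @renormalization_flips _ F tau (center l j)
  (l (ord_pred j)) (l j) (l (ordS j)) (1 - 2 * l j)
  ((tau - l j) / (1 - 2 * l j)) ((1 - l j - tau) / (1 - 2 * l j))
  (fully_subtractive l j (ord_pred j)) (fully_subtractive l j j)
  (fully_subtractive l j (ordS j))
  (admissible_neighbours j sl t2 lt) (lmin _) (lmin _)
  (three_flips_center j sl fl) erefl (LM _) (LM _) (etrans (LM' _) subP)
  (etrans (LM' _) (ifT _ _ (eqxx j))) (etrans (LM' _) subS).
have [o flo] := flips_pieces_center sl'.2 fl'.
exists o, F'; split=> //; move: fin => /=; rewrite /s_plus /s_minus.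
have [-> _] := bounds_center tau j l1.
have [Lt Lf] := piece_lengths tau j l1.
rewrite /S_length Lt Lf /=.
by rewrite (_ : 1 - l j - tau + (tau - l j) = 1 - 2 * l j) //; lra.
Qed.

Theorem theorem10 (R : realType) (l : 'I_3 -> R) (tau : R)
    (F : circle R -> circle R) :
  simplex l -> 0 <= tau <= 2^-1 -> flipped_exchange l tau F ->
  (forall j, l j <= 2^-1) -> (forall j, l j < tau) ->
  let x := fun j : 'I_3 => 1 - 2 * l j : R in
  let r := 2^-1 - tau in
  let T := F \o F in
  [/\ interval_exchange 6 T (fun k : 'I_3 * bool => Ipm l tau k.1 k.2),
      forall j,
        Ipm_length l tau j true = x j / 2 + r /\
        Ipm_length l tau j false = x j / 2 - r &
      forall j,
        neighbouring (Ipm l tau j true) (Ipm l tau j false) /\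
        neighbouring (T @` Ipm l tau j true) (T @` Ipm l tau j false)] /\
  forall j : 'I_3, (forall k, l j <= l k) ->
    let RjF := renormalization (s_minus l tau j) (s_plus l tau j) F in
    let l' := fully_subtractive l j in
    let r' := r / S_length l tau j in
    let tau' := 2^-1 - r' in
    [/\ Sj l tau j = open_arc (s_minus l tau j) (s_plus l tau j),
        finite_set [set p | Sj l tau j p /\
                            ~ exists n, return_time (Sj l tau j) F p n],
        simplex l' /\ 0 <= tau' <= 2^-1,
        in_CET3 l' tau' RjF &
        r <= r'] /\
    ((exists I : set (circle R), periodic_interval 2 RjF I) <->
     4^-1 - r / 2 < l j).
Proof.
move=> sl /andP[_ t2] fl _ lt x r T; have [l0 l1] := sl; split.
  split; first exact: square_interval_exchange.
    by move=> j; have [-> ->] := piece_lengths tau j l1; rewrite /x /r; lra.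
  by move=> j; apply: neighbouring_pieces.
move=> j lmin RjF l' r' tau'.
have lj := lt j.
have lj0 : 0 < l j by case: (admissible_neighbours j sl t2 lt); lra.
have [Lt Lf] := piece_lengths tau j l1.
have SL : S_length l tau j = 1 - 2 * l j by rewrite /S_length Lt Lf; lra.
have L0 : 0 < 1 - 2 * l j by lra.
have LM y : (1 - 2 * l j) * (y / (1 - 2 * l j)) = y.
  by rewrite mulrC divfK//; exact: lt0r_neq0.
have Lle y z : (y <= z) = ((1 - 2 * l j) * y <= (1 - 2 * l j) * z).
  by rewrite ler_pM2l.
have Llt y z : (y < z) = ((1 - 2 * l j) * y < (1 - 2 * l j) * z).
  by rewrite ltr_pM2l.
have r'E : (1 - 2 * l j) * r' = r by rewrite /r' SL LM.
have tau'E : tau' = (tau - l j) / (1 - 2 * l j).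
  by apply: (mulfI (lt0r_neq0 L0)); rewrite LM /tau' mulrBr r'E /r; lra.
have tau'M : (1 - 2 * l j) * tau' = tau - l j by rewrite tau'E LM.
have sl' : simplex l' by apply: fully_subtractive_simplex => //; lra.
have t'2 : 0 <= tau' <= 2^-1.
  rewrite (Lle 0) (Lle _ 2^-1) tau'M; lra.
have l'M k : (1 - 2 * l j) * l' k = subtract l j k.
  by rewrite /l' /fully_subtractive sum_subtract// LM.
have SjE : Sj l tau j = open_arc (s_minus l tau j) (s_plus l tau j).
  rewrite Sj_arc// /s_plus SL /s_minus; have [-> _] := bounds_center tau j l1.
  by congr open_arc => /=; lra.
have [o [F' [fl' fin]]] := renormalization_pieces sl t2 lt fl lmin.
rewrite -tau'E -/l' in fl'.
split; first split=> //.
- rewrite Sj_arc//.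
  exact: finite_no_return (admissible_neighbours j sl t2 lt) (lmin _) (lmin _)
    (three_flips_center j sl fl).
- by apply/in_CET3P; exists o, F'.
- by rewrite Lle r'E ler_piMl//; rewrite /r; lra.
(* Every step below is multiplied by 1 - 2 l_j, where l' and tau' become the
   unscaled lengths and tau - l_j. *)
split=> [[I perI]|lj4].
  have [[i]|[i]] := two_periodic_cases sl' t'2 fl' fin perI.
    rewrite Llt tau'M l'M /subtract.
    case: eqP => [_|_]; first by rewrite /r; lra.
    by have := lt i; lra.
  move=> l'0; have := l'M i; rewrite l'0 mulr0 /subtract.
  case: eqVneq => [_|ij] lij; first by rewrite /r; lra.
  by have [k lk] := third_length l1 ij; have := lt k; rewrite lk /r; lra.
apply: (two_periodic_of_long_piece _ _ (fl' j) fin).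
  have : tau' < l' j.
    by rewrite Llt tau'M l'M /subtract eqxx; move: lj4; rewrite /r; lra.
  lra.
have l'1 : l' j <= 1.
  rewrite Lle l'M /subtract eqxx; move: (lmin j1) (lmin j2) (lmin j3) l1.
  by rewrite sum3; lra.
lra.
Qed.
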